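(* Let $T\in\mathbb{C}^{m\times m}$ be a matrix with $I_m\succ T\succcurlyeq 0$. (i) Let $F_0(s)$ and $F_1(s)$ be a pair of canonical $\mathcal{HP}_T$ functions. Then the convex hull $\{\alpha F_1+(1-\alpha)F_0:\alpha\in[0,1]\}$ consists of canonical $\mathcal{HP}_T$ functions if and only if $$\big((F_0-F_1)(s)\big)^*\,T\,(F_0-F_1)(s)= 0\qquad\text{for all } s\in i\mathbb{R}.$$ Otherwise, the functions $\alpha F_1+(1-\alpha)F_0$ with $\alpha\in(0,1)$ are not canonical $\mathcal{HP}_T$ functions, and belong to $\mathcal{HP}_{\hat T}$ for some $\hat T$ with $I_m\succ\hat T\succcurlyeq T$. (ii) Whenever $F\in\mathcal{HP}_T$ is canonical, its inverse $(F(s))^{-1}$ is another canonical function within the same $\mathcal{HP}_T$. (iii) Let $\beta\in(0,1)$. Whenever $f(s)$ is a scalar canonical $\mathcal{HP}_\beta$ function, $f_1(s):=\frac12\big(f(s)+f(s)^{-1}\big)$ is a canonical function within $\mathcal{HP}_{\beta_1}$, where $\beta_1=\left(\frac12\left(\beta+\frac1\beta\right)\right)^{-1}$.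
   Context: $\mathbb{C}_R$ denotes the open right half of the complex plane, $i\mathbb{R}$ the imaginary axis, $\succcurlyeq$ ($\succ$) the positive semidefinite (positive definite) order on Hermitian matrices, and $^*$ the conjugate transpose. For $I_m\succ T\succcurlyeq 0$, an $m\times m$-valued rational function $F(s)$ is in $\mathcal{HP}_T$ ($T$-Hyper-Positive) if $F(s)+F(s)^*\succcurlyeq T+F(s)^*TF(s)$ for all $s\in\mathbb{C}_R$. A function $F\in\mathcal{HP}_T$ is called canonical if, in addition, $F(s)+F(s)^*-\big(T+F(s)^*TF(s)\big)=0$ for all $s\in i\mathbb{R}$. For $\beta\in[0,1)$, $\mathcal{HP}_\beta$ denotes $\mathcal{HP}_T$ with $T=\beta I_m$, and canonical $\mathcal{HP}_\beta$ functions are defined accordingly. $(F(s))^{-1}$ is the inverse of $F$ as a matrix-valued rational function.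
   Formalization: In (ii) the inverse is shown to be canonical under the added assumption that F is invertible as a rational matrix function, which is proved to be automatic when T is positive definite; for singular T it can fail, e.g. T = 0 and F = 0. *)

(* Defs.v *)
From HB Require Import structures.
From mathcomp Require Import all_boot all_order all_algebra.
From mathcomp Require Import sesquilinear spectral.
From mathcomp Require Import reals complex.

Set Implicit Arguments.
Unset Strict Implicit.
Unset Printing Implicit Defensive.

Import Order.TTheory GRing.Theory Num.Theory.
Local Open Scope ring_scope.
Local Open Scope sesquilinear_scope.
Local Open Scope complex_scope.

Notation "x %:F" := (@FracField.tofrac _ x) : ring_scope.

Section RationalFunctions.
Variable K : fieldType.
Implicit Types (x : {fraction {poly K}}) (s : K).

(* [ratnum x / ratden x] is [x] in lowest terms, so that the zeros of
   [ratden x] are exactly the poles of [x]; see [ratval_frac]. *)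
Definition ratnum x : {poly K} :=
  \n_(repr x) %/ gcdp \n_(repr x) \d_(repr x).
Definition ratden x : {poly K} :=
  \d_(repr x) %/ gcdp \n_(repr x) \d_(repr x).

Definition ratregular x s : bool := (ratden x).[s] != 0.

(* Only meaningful where [ratregular x s] holds. *)
Definition ratval x s : K := (ratnum x).[s] / (ratden x).[s].

Lemma frac_repr x : x = (\n_(repr x))%:F / (\d_(repr x))%:F.
Proof.
apply: (canRL (mulfK _)); first by rewrite tofrac_eq0; exact: denom_ratioP.
rewrite -{1}[x]reprK; set r := repr x.
unlock FracField.tofrac; rewrite -[LHS]FracField.pi_mul.
apply/eqmodP; rewrite /= FracField.equivfE /FracField.mulf.
by rewrite !numden_Ratio ?mulf_neq0 ?oner_neq0 ?denom_ratioP // mulr1 mulrAC mulr1 mulrC.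
Qed.

Lemma frac_cross (n d p q : {poly K}) : d != 0 -> q != 0 ->
  p%:F / q%:F = n%:F / d%:F -> n * q = p * d.
Proof.
move=> d0 q0 /eqP.
rewrite (can2_eq (divfK _) (mulfK _)) ?tofrac_eq0 // mulrAC.
rewrite eq_sym (can2_eq (divfK _) (mulfK _)) ?tofrac_eq0 // -!tofracM tofrac_eq.
by move/eqP.
Qed.

Lemma ratval_frac (p q : {poly K}) s : q.[s] != 0 ->
  ratregular (p%:F / q%:F) s /\ ratval (p%:F / q%:F) s = p.[s] / q.[s].
Proof.
move=> qs; rewrite /ratregular /ratval /ratnum /ratden.
have q0 : q != 0 by apply: contraNneq qs => ->; rewrite horner0.
set x := p%:F / q%:F.
have := frac_repr x; have := denom_ratioP (repr x).
move: \n_(repr x) \d_(repr x) => n d d0 /(frac_cross d0 q0) nq.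
set g := gcdp n d; have g0 : g != 0 by rewrite gcdp_eq0 negb_and d0 orbT.
have en : n = n %/ g * g by rewrite divpK // dvdp_gcdl.
have ed : d = d %/ g * g by rewrite divpK // dvdp_gcdr.
set n' := n %/ g in en *; set d' := d %/ g in ed *.
have nq' : n' * q = p * d'.
  by apply: (mulIf g0); rewrite mulrAC -en -mulrA -ed.
have cop : coprimep d' n' by rewrite coprimep_sym coprimep_div_gcd ?d0 ?orbT.
have dq : d' %| q.
  by rewrite -(Gauss_dvdpr q cop) nq' dvdp_mull.
have d's : d'.[s] != 0.
  apply: contraNneq qs => d's0; case/dvdpP: dq => u ->.
  by rewrite hornerM d's0 mulr0.
split=> //; by apply/eqP; rewrite eqr_div // -!hornerM nq'.
Qed.
End RationalFunctions.

Section HyperPositive.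
Variable R : realType.
Local Notation C := R[i].

Definition ratmx (m : nat) := 'M[{fraction {poly C}}]_m.

Definition mxregular m (F : ratmx m) (s : C) : Prop :=
  forall i j, ratregular (F i j) s.

Definition mxval m (F : ratmx m) (s : C) : 'M[C]_m :=
  \matrix_(i, j) ratval (F i j) s.

(* A complex number is [0 <= _] in [C] only if it is real. *)
Definition psdmx m (A : 'M[C]_m) : Prop :=
  A \is hermsymmx /\ forall v : 'cV[C]_m, 0 <= (v ^t* *m A *m v) 0 0.

Definition pdmx m (A : 'M[C]_m) : Prop :=
  A \is hermsymmx /\
  forall v : 'cV[C]_m, v != 0 -> 0 < (v ^t* *m A *m v) 0 0.

Definition loewner_le m (A B : 'M[C]_m) : Prop := psdmx (B - A).
Definition loewner_lt m (A B : 'M[C]_m) : Prop := pdmx (B - A).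

(* A function in HP_T has no pole in the open right half-plane: its values are
   required at every point there. *)
Definition HP m (T : 'M[C]_m) (F : ratmx m) : Prop :=
  forall s : C, 0 < complex.Re s ->
    mxregular F s /\
    loewner_le (T + (mxval F s) ^t* *m T *m mxval F s)
               (mxval F s + (mxval F s) ^t*).

(* When T is singular F may have poles on the imaginary axis (e.g. 1/s with
   T = 0); the equality is imposed at the other points of the axis. *)
Definition canonical_HP m (T : 'M[C]_m) (F : ratmx m) : Prop :=
  HP T F /\
  forall s : C, complex.Re s = 0 -> mxregular F s ->
    mxval F s + (mxval F s) ^t*
      - (T + (mxval F s) ^t* *m T *m mxval F s) = 0.

Definition cvx_comb m (F0 F1 : ratmx m) (a : R) : ratmx m :=
  (a%:C%:P)%:F *: F1 + ((1 - a)%:C%:P)%:F *: F0.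

(* Scalar functions are 1 x 1 matrix-valued ones. *)
Definition scalar_canonical_HP (b : R) (f : {fraction {poly C}}) : Prop :=
  canonical_HP (b%:C%:M : 'M[C]_1) (f%:M : ratmx 1).

End HyperPositive.

(* Main.v *)
(** The defect [D(A) = A + A^* - (T + A^* T A)] of a convex combination is the
    convex combination of the defects plus
    [a (1 - a) (A0 - A1)^* T (A0 - A1)], which gives (i); it transforms by
    congruence under inversion, [D(A^-1) = A^-* D(A) A^-1], which gives (ii);
    and in the scalar case the defect for [b1] of [(z + z^-1) / 2] is a
    nonnegative multiple of the defect for [b] of [z], which gives (iii).

    Two facts handle the exceptional points. Conjugation is rational on the
    imaginary axis, so an identity valid there off finitely many points holds
    at every regular point. And the inverse of [F] has no pole in the open
    right half-plane even when [T] is singular: a vector in the kernel of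
    [F(s0)] is, by a maximum principle for rational functions of nonnegative
    real part, in the kernel of [F]. *)

Require Import Defs.
From HB Require Import structures.
From mathcomp Require Import all_boot all_order all_algebra.
From mathcomp Require Import sesquilinear spectral.
From mathcomp Require Import reals complex.
From mathcomp Require Import ring lra.

Set Implicit Arguments.
Unset Strict Implicit.
Unset Printing Implicit Defensive.

Import Order.TTheory GRing.Theory Num.Theory.
Local Open Scope ring_scope.
Local Open Scope sesquilinear_scope.
Local Open Scope complex_scope.

(** * Values of rational functions and rational matrices at a point *)

Section RationalValues.
Variable K : fieldType.
Implicit Types (x y : {fraction {poly K}}) (s c d : K).

(** Any fraction [p / q] with [q] nonzero at [s] is accepted, not only the one in lowest terms, so
    that closure under arithmetic involves no gcd. *)
Definition has_val x s c : Prop :=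
  exists p q : {poly K}, [/\ q.[s] != 0, x = p%:F / q%:F & c = p.[s] / q.[s]].

Lemma has_val_regular x s c : has_val x s c -> ratregular x s.
Proof. by move=> [p] [q] [q0 -> _]; case: (ratval_frac p q0). Qed.

Lemma has_val_ratval x s c : has_val x s c -> ratval x s = c.
Proof. by move=> [p] [q] [q0 -> ->]; case: (ratval_frac p q0). Qed.

Lemma ratden_neq0 x : ratden x != 0.
Proof.
have d0 := denom_ratioP (repr x).
rewrite /ratden dvdp_div_eq0 ?dvdp_gcdr //.
Qed.

Lemma frac_lowest_terms x : x = (ratnum x)%:F / (ratden x)%:F.
Proof.
have d0 := denom_ratioP (repr x).
rewrite [LHS]frac_repr /ratnum /ratden.
set n := \n_(repr x); set d := \d_(repr x); set g := gcdp n d.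
have g0 : g%:F != 0 by rewrite tofrac_eq0 gcdp_eq0 negb_and d0 orbT.
have en : n = n %/ g * g by rewrite divpK // dvdp_gcdl.
have ed : d = d %/ g * g by rewrite divpK // dvdp_gcdr.
by rewrite {1}en {1}ed !tofracM invfM mulrACA divff ?mulr1.
Qed.

Lemma regular_has_val x s : ratregular x s -> has_val x s (ratval x s).
Proof. by move=> xs; exists (ratnum x), (ratden x); split => //; exact: frac_lowest_terms. Qed.

Lemma has_val_const c s : has_val (c%:P)%:F s c.
Proof. by exists c%:P, 1; rewrite !hornerE oner_neq0 tofrac1 !divr1. Qed.

Lemma has_valD x y s c d : has_val x s c -> has_val y s d -> has_val (x + y) s (c + d).
Proof.
move=> [p] [q] [q0 -> ->] [p'] [q'] [q0' -> ->].
exists (p * q' + p' * q), (q * q'); rewrite !(hornerM, hornerD) mulf_neq0 //.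
have nz (r : {poly K}) : r.[s] != 0 -> r%:F != 0.
  by rewrite tofrac_eq0; apply: contraNneq => ->; rewrite horner0.
by split; rewrite // ?tofracD ?tofracM addf_div ?nz.
Qed.

Lemma has_valM x y s c d : has_val x s c -> has_val y s d -> has_val (x * y) s (c * d).
Proof.
move=> [p] [q] [q0 -> ->] [p'] [q'] [q0' -> ->].
exists (p * p'), (q * q'); rewrite !hornerM mulf_neq0 //.
by split; rewrite // ?tofracM mulf_div.
Qed.

Lemma has_valN x s c : has_val x s c -> has_val (- x) s (- c).
Proof.
move=> [p] [q] [q0 -> ->]; exists (- p), q.
by split; rewrite // ?hornerN ?tofracN mulNr.
Qed.

Lemma has_valV x s c : c != 0 -> has_val x s c -> has_val x^-1 s c^-1.
Proof.
move=> c0 [p] [q] [q0 -> ec]; exists q, p.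
by move: c0; rewrite ec mulf_eq0 invr_eq0 negb_or => /andP[-> _]; rewrite !invf_div.
Qed.

Lemma has_val0 s : has_val 0 s 0.
Proof. by have := has_val_const 0 s; rewrite polyC0 tofrac0. Qed.

Lemma has_val1 s : has_val 1 s 1.
Proof. by have := has_val_const 1 s; rewrite polyC1 tofrac1. Qed.

Lemma has_val_sum (I : Type) (r : seq I) (P : pred I) F f s :
  (forall i, P i -> has_val (F i) s (f i)) ->
  has_val (\sum_(i <- r | P i) F i) s (\sum_(i <- r | P i) f i).
Proof.
move=> Ff; apply: (big_ind2 (fun x c => has_val x s c)) => //; first exact: has_val0.
by move=> *; exact: has_valD.
Qed.

Lemma has_val_prod (I : Type) (r : seq I) (P : pred I) F f s :
  (forall i, P i -> has_val (F i) s (f i)) ->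
  has_val (\prod_(i <- r | P i) F i) s (\prod_(i <- r | P i) f i).
Proof.
move=> Ff; apply: (big_ind2 (fun x c => has_val x s c)) => //; first exact: has_val1.
by move=> *; exact: has_valM.
Qed.

Lemma has_val_sign (n : nat) s : has_val ((-1) ^+ n) s ((-1) ^+ n).
Proof. by elim: n => [|n ih]; rewrite ?exprS; [exact: has_val1|apply: has_valM ih; apply/has_valN/has_val1]. Qed.

Definition has_mxval m n (F : 'M[{fraction {poly K}}]_(m, n)) s (A : 'M[K]_(m, n)) : Prop :=
  forall i j, has_val (F i j) s (A i j).

Definition constmx m n (A : 'M[K]_(m, n)) : 'M[{fraction {poly K}}]_(m, n) :=
  map_mx (fun c => (c%:P)%:F) A.

Lemma has_mxval_const m n (A : 'M[K]_(m, n)) s : has_mxval (constmx A) s A.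
Proof. by move=> i j; rewrite mxE; exact: has_val_const. Qed.

Lemma has_mxvalD m n (F G : 'M[{fraction {poly K}}]_(m, n)) s A B :
  has_mxval F s A -> has_mxval G s B -> has_mxval (F + G) s (A + B).
Proof. by move=> FA GB i j; rewrite !mxE; exact: has_valD. Qed.

Lemma has_mxvalN m n (F : 'M[{fraction {poly K}}]_(m, n)) s A :
  has_mxval F s A -> has_mxval (- F) s (- A).
Proof. by move=> FA i j; rewrite !mxE; exact: has_valN. Qed.

Lemma has_mxvalM m n p (F : 'M[{fraction {poly K}}]_(m, n)) (G : 'M_(n, p)) s A B :
  has_mxval F s A -> has_mxval G s B -> has_mxval (F *m G) s (A *m B).
Proof.
by move=> FA GB i j; rewrite !mxE; apply: has_val_sum => k _; exact: has_valM.
Qed.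

Lemma has_mxvalZ m n x (F : 'M[{fraction {poly K}}]_(m, n)) s c A :
  has_val x s c -> has_mxval F s A -> has_mxval (x *: F) s (c *: A).
Proof. by move=> xc FA i j; rewrite !mxE; exact: has_valM. Qed.

Lemma has_val_det n (F : 'M[{fraction {poly K}}]_n) s A :
  has_mxval F s A -> has_val (\det F) s (\det A).
Proof.
move=> FA; apply: has_val_sum => sg _; apply: has_valM; first exact: has_val_sign.
by apply: has_val_prod.
Qed.

Lemma has_mxval_adj n (F : 'M[{fraction {poly K}}]_n) s A :
  has_mxval F s A -> has_mxval (\adj F) s (\adj A).
Proof.
move=> FA i j; rewrite !mxE; apply: has_valM; first exact: has_val_sign.
by apply: has_val_det => k l; rewrite !mxE.
Qed.

(** By Cramer's formula the inverse is the adjugate divided by [\det F], whose value [\det A] at [s]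
    is nonzero. *)
Lemma has_mxvalV n (F : 'M[{fraction {poly K}}]_n) s A :
  F \in unitmx -> A \in unitmx ->
  has_mxval F s A -> has_mxval (invmx F) s (invmx A).
Proof.
move=> Fu Au FA; rewrite /invmx Fu Au.
apply: has_mxvalZ; last exact: has_mxval_adj.
by apply: has_valV; [rewrite -unitfE -unitmxE|exact: has_val_det].
Qed.

(** The exceptional points are confined to the roots of one nonzero polynomial, so finite
    conjunctions amount to products of polynomials. *)
Definition cofinitely (P : K -> Prop) : Prop :=
  exists2 p : {poly K}, p != 0 & forall s, p.[s] != 0 -> P s.

Lemma cofinitely_and (P Q : K -> Prop) :
  cofinitely P -> cofinitely Q -> cofinitely (fun s => P s /\ Q s).
Proof.
move=> [p p0 pP] [q q0 qQ]; exists (p * q); first exact: mulf_neq0.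
by move=> s; rewrite hornerM mulf_eq0 negb_or => /andP[/pP ? /qQ].
Qed.

Lemma cofinitely_imp (P Q : K -> Prop) :
  (forall s, P s -> Q s) -> cofinitely P -> cofinitely Q.
Proof. by move=> PQ [p p0 pP]; exists p => // s /pP/PQ. Qed.

Lemma cofinitely_forall (I : finType) (P : I -> K -> Prop) :
  (forall i, cofinitely (P i)) -> cofinitely (fun s => forall i, P i s).
Proof.
move=> /fin_all_exists2[p p0 pP]; exists (\prod_i p i).
  by apply/prodf_neq0 => i _.
move=> s; rewrite horner_prod => /prodf_neq0 ps i; exact/pP/ps.
Qed.

Lemma cofinitely_regular x : cofinitely (ratregular x).
Proof. by exists (ratden x) => //; exact: ratden_neq0. Qed.

Lemma cofinitely_regularmx m n (F : 'M[{fraction {poly K}}]_(m, n)) :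
  cofinitely (fun s => forall i j, ratregular (F i j) s).
Proof.
by apply: cofinitely_forall => i; apply: cofinitely_forall => j; exact: cofinitely_regular.
Qed.

End RationalValues.

(** * Identities between rational functions and their conjugates on the imaginary axis *)

Section ImaginaryAxis.
Variable R : realType.
Local Notation C := R[i].
Implicit Types (D : C -> Prop) (f g : C -> C) (p q : {poly C}) (s : C).

(** The points [k * i] for natural [k] below [size p] are distinct roots, one more than the degree
    of a nonzero [p] allows. *)
Lemma poly_axis_eq0 p : (forall s, complex.Re s = 0 -> p.[s] = 0) -> p = 0.
Proof.
move=> p0; apply: (@roots_geq_poly_eq0 _ p [seq (0 +i* k%:R : C) | k <- iota 0 (size p)]).
- by apply/allP => _ /mapP[k _ ->]; apply/eqP/p0.
- rewrite map_inj_uniq ?iota_uniq // => j k /= [] /eqP.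
  by rewrite eqr_nat => /eqP.
- by rewrite size_map size_iota.
Qed.

Lemma conjC_axis s : complex.Re s = 0 -> Num.conj s = - s.
Proof. by case: s => a b /= ->; apply/eqP; rewrite eq_complex /= oppr0 !eqxx. Qed.

Lemma horner_conj_axis p s : complex.Re s = 0 ->
  (map_poly Num.conj p \Po - 'X).[s] = Num.conj p.[s].
Proof. by move=> s0; rewrite horner_comp hornerN hornerX -conjC_axis // horner_map. Qed.

(** One pair [p], [q] serves all points of [D] on the axis. Nothing is asked off the axis, so [f]
    may involve conjugates, which are not rational in the whole plane. *)
Definition axis_rational D f : Prop :=
  exists p q, forall s, complex.Re s = 0 -> D s -> q.[s] != 0 /\ f s = p.[s] / q.[s].

Lemma axis_rational_ext D f g :
  (forall s, f s = g s) -> axis_rational D f -> axis_rational D g.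
Proof. by move=> fg [p [q pq]]; exists p, q => s s0 Ds; rewrite -fg; exact: pq. Qed.

Lemma axis_rational_const D c : axis_rational D (fun=> c).
Proof. by exists c%:P, 1 => s _ _; rewrite !hornerE oner_neq0 divr1. Qed.

Lemma axis_rationalD D f g : axis_rational D f -> axis_rational D g ->
  axis_rational D (fun s => f s + g s).
Proof.
move=> [p [q pq]] [p' [q' pq']]; exists (p * q' + p' * q), (q * q') => s s0 Ds.
have [q0 ->] := pq s s0 Ds; have [q0' ->] := pq' s s0 Ds.
by rewrite !(hornerM, hornerD) mulf_neq0 // addf_div.
Qed.

Lemma axis_rationalM D f g : axis_rational D f -> axis_rational D g ->
  axis_rational D (fun s => f s * g s).
Proof.
move=> [p [q pq]] [p' [q' pq']]; exists (p * p'), (q * q') => s s0 Ds.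
have [q0 ->] := pq s s0 Ds; have [q0' ->] := pq' s s0 Ds.
by rewrite !(hornerM, hornerD) mulf_neq0 // mulf_div.
Qed.

Lemma axis_rationalN D f : axis_rational D f -> axis_rational D (fun s => - f s).
Proof.
move=> [p [q pq]]; exists (- p), q => s s0 Ds.
by have [q0 ->] := pq s s0 Ds; rewrite hornerN mulNr.
Qed.

(* On the axis the conjugate of [s] is [- s], which makes conjugation rational there. *)
Lemma axis_rational_conj D f : axis_rational D f ->
  axis_rational D (fun s => Num.conj (f s)).
Proof.
move=> [p [q pq]].
exists (map_poly Num.conj p \Po - 'X), (map_poly Num.conj q \Po - 'X) => s s0 Ds.
by have [q0 ->] := pq s s0 Ds; rewrite !horner_conj_axis // conjC_eq0 rmorphM /= fmorphV.
Qed.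

Lemma axis_rational_sum D (I : Type) (r : seq I) (F : I -> C -> C) :
  (forall i, axis_rational D (F i)) ->
  axis_rational D (fun s => \sum_(i <- r) F i s).
Proof.
move=> DF; elim: r => [|i r ih].
  by apply: axis_rational_ext (axis_rational_const D 0) => s; rewrite big_nil.
by apply: axis_rational_ext (axis_rationalD (DF i) ih) => s; rewrite big_cons.
Qed.

(** The numerator [p] times the two exceptional polynomials [d] and [e] vanishes on the whole axis,
    hence is zero; cancelling [d * e] leaves [p = 0]. *)
Lemma axis_rational_eq0 D f : axis_rational D f -> cofinitely D ->
  cofinitely (fun s => complex.Re s = 0 -> f s = 0) ->
  forall s, complex.Re s = 0 -> D s -> f s = 0.
Proof.
move=> [p [q pq]] [d d0 dD] [e e0 ef].
suff p0 : p = 0 by move=> s s0 Ds; have [_ ->] := pq s s0 Ds; rewrite p0 horner0 mul0r.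
apply: (mulfI (mulf_neq0 d0 e0)); rewrite mulr0; apply: poly_axis_eq0 => s s0.
rewrite !hornerM; have [->|ds] := eqVneq d.[s] 0; first by rewrite !mul0r.
have [->|es] := eqVneq e.[s] 0; first by rewrite mulr0 mul0r.
have [q0 fs] := pq s s0 (dD _ ds); move/eqP: (ef s es s0).
by rewrite fs mulf_eq0 invr_eq0 (negPf q0) orbF => /eqP->; rewrite mulr0.
Qed.

Definition axis_rationalmx D m n (M : C -> 'M[C]_(m, n)) : Prop :=
  forall i j, axis_rational D (fun s => M s i j).

Lemma axis_rationalmx_val D m (F : ratmx R m) :
  (forall s, D s -> mxregular F s) -> axis_rationalmx D (mxval F).
Proof.
move=> DF i j; exists (ratnum (F i j)), (ratden (F i j)) => s _ /DF/(_ i j) reg.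
by rewrite mxE.
Qed.

Lemma axis_rationalmx_const D m n (A : 'M[C]_(m, n)) : axis_rationalmx D (fun=> A).
Proof. by move=> i j; exact: axis_rational_const. Qed.

Lemma axis_rationalmxD D m n (M N : C -> 'M[C]_(m, n)) :
  axis_rationalmx D M -> axis_rationalmx D N -> axis_rationalmx D (fun s => M s + N s).
Proof.
move=> DM DN i j; apply: axis_rational_ext (axis_rationalD (DM i j) (DN i j)) => s.
by rewrite mxE.
Qed.

Lemma axis_rationalmxN D m n (M : C -> 'M[C]_(m, n)) :
  axis_rationalmx D M -> axis_rationalmx D (fun s => - M s).
Proof. by move=> DM i j; apply: axis_rational_ext (axis_rationalN (DM i j)) => s; rewrite mxE. Qed.

Lemma axis_rationalmx_adjoint D m n (M : C -> 'M[C]_(m, n)) :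
  axis_rationalmx D M -> axis_rationalmx D (fun s => (M s) ^t*).
Proof.
by move=> DM i j; apply: axis_rational_ext (axis_rational_conj (DM j i)) => s; rewrite !mxE.
Qed.

Lemma axis_rationalmxM D m n l (M : C -> 'M[C]_(m, n)) (N : C -> 'M[C]_(n, l)) :
  axis_rationalmx D M -> axis_rationalmx D N -> axis_rationalmx D (fun s => M s *m N s).
Proof.
move=> DM DN i j.
have := axis_rational_sum (index_enum 'I_n) (fun k => axis_rationalM (DM i k) (DN k j)).
by apply: axis_rational_ext => s; rewrite mxE.
Qed.

Lemma axis_rationalmx_eq0 D m n (M : C -> 'M[C]_(m, n)) :
  axis_rationalmx D M -> cofinitely D ->
  cofinitely (fun s => complex.Re s = 0 -> M s = 0) ->
  forall s, complex.Re s = 0 -> D s -> M s = 0.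
Proof.
move=> DM cD cM s s0 Ds; apply/matrixP => i j; rewrite mxE.
apply: (axis_rational_eq0 (DM i j) cD _ s0 Ds).
by apply: cofinitely_imp cM => z M0 /M0->; rewrite mxE.
Qed.

End ImaginaryAxis.

(** * A maximum principle for rational functions of nonnegative real part *)

Section MaximumPrinciple.
Variable R : realType.
Local Notation C := R[i].
Implicit Types (p q : {poly C}) (s : C).

(** Supplies the step length [t] below: [s0 + t * d] stays in the open half-plane ([a], [b] are the
    real parts of [s0], [d]), and the error [t * e] stays under the size [w] of the leading term. *)
Lemma exists_small (a w b e : R) : 0 < a -> 0 < w ->
  exists t : R, [/\ 0 < t, t <= 1, 0 < a + t * b & t * e < w].
Proof.
move=> a0 w0; pose n := 1 + `|b| / a + `|e| / w.
have ba : 0 <= `|b| / a by rewrite divr_ge0 // ltW.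
have ew : 0 <= `|e| / w by rewrite divr_ge0 // ltW.
have n0 : 0 < n by rewrite /n; lra.
have bn : `|b| < n * a by rewrite -ltr_pdivrMr // /n; lra.
have en : `|e| < n * w by rewrite -ltr_pdivrMr // /n; lra.
have nb : - (n * a) < b by case/ltr_normlP: bn => *; lra.
exists n^-1; rewrite invr_gt0 n0 invf_le1 //; split => //.
- by rewrite /n; lra.
- have := ltr_pM2l (n0 : 0 < n) 0 (a + n^-1 * b); rewrite mulr0 => <-.
  by rewrite mulrDr mulVKf ?lt0r_neq0 // -ltrBlDl sub0r.
- by rewrite mulrC ltr_pdivrMr // mulrC; apply: le_lt_trans en; exact: ler_norm.
Qed.

(** The two numbers differ by the nonnegative factor [|w|^2]; this clears the denominator of a value
    without changing the sign of its real part. *)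
Lemma Re_mul_conj (z w : C) : 0 <= complex.Re (z / w) -> 0 <= complex.Re (z * Num.conj w).
Proof.
have [->|w0] := eqVneq w 0; first by rewrite rmorph0 mulr0.
have -> : z * Num.conj w = (`|w| ^+ 2) * (z / w) by rewrite normCK; field.
rewrite -add_Re2_Im2 => zw; move: (_ + _) (addr_ge0 (sqr_ge0 (complex.Re w)) (sqr_ge0 (complex.Im w))).
by case: (z / w) zw => x y /= x0 r r0; rewrite mul0r subr0 mulr_ge0.
Qed.

(* Near a zero [s0] of order [k] with leading coefficient [c], the value at
   [s0 + t * d] is about [c * d ^+ k * t ^+ k], and [d] can be chosen to make
   [c * d ^+ k] negative. *)
Lemma zero_of_positive_real (g : {fraction {poly C}}) s0 :
  (forall s, 0 < complex.Re s -> ratregular g s /\ 0 <= complex.Re (ratval g s)) ->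
  0 < complex.Re s0 -> ratval g s0 = 0 -> g = 0.
Proof.
move=> gpos s0pos g0; apply/eqP/negP => /negP gn0.
set p := ratnum g; set q := ratden g.
have qreg s : 0 < complex.Re s -> q.[s] != 0 by case/gpos.
have p0 : p != 0.
  apply: contraNneq gn0 => p0; rewrite [g]frac_lowest_terms -/p p0.
  by rewrite tofrac0 mul0r.
have [k [p1 + ep]] := multiplicity_XsubC p s0; rewrite p0 /= => /negP/negP p10.
have k0 : (0 < k)%N.
  rewrite lt0n; apply: contraNneq p10 => k0; rewrite k0 expr0 mulr1 in ep.
  rewrite /root -ep; move/eqP: g0.
  by rewrite /ratval -/p -/q mulf_eq0 invr_eq0 (negPf (qreg _ s0pos)) orbF.
pose c := p1.[s0] * Num.conj q.[s0].
have c0 : c != 0 by rewrite mulf_neq0 ?conjC_eq0 ?qreg.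
(* With this direction [c * d ^+ k] equals [- |c|^2]. *)
pose d := k.-root (- Num.conj c).
have dk : d ^+ k = - Num.conj c by rewrite rootCK.
pose line : {poly C} := s0%:P + d *: 'X.
have lineE t : line.[t] = s0 + t * d by rewrite !hornerE mulrC.
(* For real [t], [t ^+ k * w.[t]] is [p * conj q] at [s0 + t * d]. Conjugating the coefficients
   keeps [w] a polynomial, since [t] is its own conjugate. *)
pose w := (d ^+ k)%:P * ((p1 \Po line) * map_poly Num.conj (q \Po line)).
have wE (t : R) : w.[t%:C] = d ^+ k * (p1.[s0 + t%:C * d] * Num.conj q.[s0 + t%:C * d]).
  have tJ : Num.conj t%:C = t%:C by exact: conjc_real.
  by rewrite !hornerM hornerC horner_comp lineE -{2}tJ horner_map horner_comp lineE.
have w0 : w.[0] = - (`|c| ^+ 2).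
  by rewrite -[0]/((0 : R)%:C) wE rmorph0 mul0r addr0 dk mulNr mulrC normCK.
have [u eu] : exists u, w - w.[0]%:P = u * ('X - 0%:P).
  by apply/factor_theorem; rewrite /root !hornerE subrr.
(* A bound for [u] on the unit disc gives [|w.[t] - w.[0]| <= t * B] for [t] in [[0, 1]], while
   [w.[0] = - |c|^2]. *)
have [B Bu] := poly_disk_bound u 1.
have c2 : 0 < `|c| ^+ 2 by rewrite exprn_gt0 ?normr_gt0.
have [t [t0 t1 st tB]] := exists_small (complex.Re d) (complex.Re B) s0pos
   (proj2 (andP (etrans (esym (ltcE _ _)) c2))).
have t0C : 0 < t%:C by rewrite (ltcR 0).
have spos : 0 < complex.Re (s0 + t%:C * d).
  by move: st; case: (s0) (d) => a b [a' b'] /=; rewrite mul0r subr0.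
have [_] := gpos _ spos; rewrite /ratval -/p -/q => /Re_mul_conj.
rewrite ep hornerM horner_exp !hornerE.
have -> : p1.[s0 + t%:C * d] * (s0 + t%:C * d - s0) ^+ k * Num.conj q.[s0 + t%:C * d]
  = t%:C ^+ k * w.[t%:C].
  by rewrite wE [s0 + _ - _]addrAC subrr add0r exprMn; ring.
have tk : 0 < t ^+ k by rewrite exprn_gt0.
have wt : w.[t%:C] = - (`|c| ^+ 2) + t%:C * u.[t%:C].
  by rewrite -w0 -[w in LHS](subrK w.[0]%:P) eu hornerD hornerM hornerXsubC hornerC subr0 addrC mulrC.
rewrite -rmorphXn /= wt leNgt => /negP; apply.
have Bt : `|u.[t%:C]| <= B by apply: Bu; rewrite ger0_norm ?(ltW t0C) // (lecR _ 1).
move: (le_trans (normc_ge_Re _) Bt) tB c2; rewrite lecE ltcE.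
case: (`|c| ^+ 2) (u.[_]) (B) => [x y] [x' y'] [x'' y''] /= /andP[_ xx] tx /andP[/eqP-> x0].
rewrite !(mul0r, subr0) pmulr_rlt0 //.
have : t * x' <= t * x'' by rewrite ler_pM2l // (le_trans _ xx) ?ler_norm.
lra.
Qed.

End MaximumPrinciple.

(** * Hermitian forms and the algebra of the defect *)

Section HermitianForms.
Variable C : numClosedFieldType.

Lemma adjmxM m n l (A : 'M[C]_(m, n)) (B : 'M[C]_(n, l)) :
  (A *m B) ^t* = B ^t* *m A ^t*.
Proof. by rewrite trmx_mul map_mxM. Qed.

Lemma adjmxD m n (A B : 'M[C]_(m, n)) : (A + B) ^t* = A ^t* + B ^t*.
Proof. by rewrite linearD /= map_mxD. Qed.

Lemma adjmxZ m n c (A : 'M[C]_(m, n)) : (c *: A) ^t* = Num.conj c *: A ^t*.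
Proof. by rewrite linearZ /= map_mxZ. Qed.

Lemma adjmx_scalar n (c : C) : (c%:M : 'M_n) ^t* = (Num.conj c)%:M.
Proof. by rewrite tr_scalar_mx map_scalar_mx. Qed.

Lemma hermsymP n (A : 'M[C]_n) : reflect (A ^t* = A) (A \is hermsymmx).
Proof. by rewrite is_hermitianmxE expr0 scale1r eq_sym; apply: eqP. Qed.

Lemma adjmx_mul_ge0 n (v : 'cV[C]_n) : 0 <= (v ^t* *m v) 0 0.
Proof. by rewrite mxE sumr_ge0 // => i _; rewrite !mxE mulrC mul_conjC_ge0. Qed.

Lemma adjmx_mul_eq0 n (v : 'cV[C]_n) : (v ^t* *m v) 0 0 = 0 -> v = 0.
Proof.
rewrite mxE => /eqP; rewrite psumr_eq0; last first.
  by move=> i _; rewrite !mxE mulrC mul_conjC_ge0.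
move=> /allP v0; apply/matrixP => i j; rewrite ord1 !mxE.
by have := v0 i (mem_index_enum i); rewrite /= !mxE mulrC mul_conjC_eq0 => /eqP.
Qed.

Lemma sesqui_lin_comb m n (T : 'M[C]_m) (A B : 'M[C]_(m, n)) (x y : C) :
  Num.conj x = x -> Num.conj y = y ->
  (x *: A + y *: B) ^t* *m T *m (x *: A + y *: B) =
  (x * x) *: (A ^t* *m T *m A) + (x * y) *: (A ^t* *m T *m B + B ^t* *m T *m A)
  + (y * y) *: (B ^t* *m T *m B).
Proof.
move=> xJ yJ; rewrite adjmxD !adjmxZ xJ yJ mulmxDl mulmxDr 2!mulmxDl.
rewrite -!scalemxAl -!scalemxAr.
move: (A ^t* *m T *m A) (A ^t* *m T *m B) (B ^t* *m T *m A) (B ^t* *m T *m B).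
by move=> P Q U V; apply/matrixP => i j; rewrite !mxE; ring.
Qed.

(** The matrix whose semidefiniteness [HP] requires and whose vanishing on the axis [canonical_HP]
    requires; both unfold to it by conversion. *)
Definition defect n (T A : 'M[C]_n) : 'M[C]_n := A + A ^t* - (T + A ^t* *m T *m A).

(** All terms are affine in [A] except [A^* T A], whose failure to be affine is the last summand. *)
Lemma defect_cvx n (T A0 A1 : 'M[C]_n) (x y : C) : Num.conj x = x -> Num.conj y = y -> x + y = 1 ->
  defect T (x *: A1 + y *: A0) =
  x *: defect T A1 + y *: defect T A0 + (x * y) *: ((A0 - A1) ^t* *m T *m (A0 - A1)).
Proof.
move=> xJ yJ xy.
(* In this shape one expansion lemma handles both quadratic terms. *)
have -> : A0 - A1 = (-1) *: A1 + 1 *: A0 by rewrite scaleN1r scale1r addrC.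
rewrite /defect !sesqui_lin_comb ?rmorphN ?rmorph1 // adjmxD !adjmxZ xJ yJ.
move: (A0 ^t* *m T *m A0) (A0 ^t* *m T *m A1) (A1 ^t* *m T *m A0) (A1 ^t* *m T *m A1).
move: (A0 ^t*) (A1 ^t*) => B0 B1 Q00 Q01 Q10 Q11.
have -> : y = 1 - x by rewrite -xy addrAC subrr add0r.
by apply/matrixP => i j; rewrite !mxE; ring.
Qed.

(** Congruence by [A^-1] takes [A], [A^*] to the adjoint of [A^-1] and [A^-1] itself, and
    interchanges the roles of [T] and [A^* T A]. *)
Lemma defect_inv n (T A : 'M[C]_n) : A \in unitmx ->
  defect T (invmx A) = (invmx A) ^t* *m defect T A *m invmx A.
Proof.
move=> Au; have VA : (invmx A) ^t* *m A ^t* = 1%:M.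
  by rewrite -adjmxM mulmxV // adjmx_scalar rmorph1.
rewrite /defect mulmxBr mulmxBl !mulmxDr !mulmxDl.
rewrite -(mulmxA _ A) mulmxV // mulmx1 VA mul1mx.
congr (_ - _); first by rewrite addrC.
by rewrite addrC; congr (_ + _); rewrite !mulmxA VA mul1mx -mulmxA mulmxV // mulmx1.
Qed.

(** A null vector of [A] thus makes the defect form negative when [T] is positive definite. *)
Lemma form_defect_kernel n (T A : 'M[C]_n) (v : 'cV[C]_n) : A *m v = 0 ->
  (v ^t* *m defect T A *m v) 0 0 = - (v ^t* *m T *m v) 0 0.
Proof.
move=> Av; have Av' : v ^t* *m A ^t* = 0 by rewrite -adjmxM Av trmx0 map_mx0.
rewrite /defect mulmxBr mulmxBl !mulmxDr !mulmxDl.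
rewrite -(mulmxA _ A) Av !mulmxA Av' !(mulmx0, mul0mx, add0r, addr0).
by rewrite mxE.
Qed.

(* With [w = A v], the form at [w - c v] equals [w^* A w - 2 c w^* w], which
   takes a negative value for large [c] unless [w = 0]. *)
Lemma psd_form_kernel n (A : 'M[C]_n) (v : 'cV[C]_n) :
  A \is hermsymmx -> (forall u : 'cV[C]_n, 0 <= (u ^t* *m A *m u) 0 0) ->
  (v ^t* *m A *m v) 0 0 = 0 -> A *m v = 0.
Proof.
move=> /hermsymP hA pA v0; set w := A *m v.
apply: adjmx_mul_eq0; apply/eqP/negP => /negP N0.
have vA : v ^t* *m A = w ^t* by rewrite adjmxM hA.
(* The sign is absorbed in [c]: the form at [w + c v] is [w^* A w + 2 c w^* w], which this choice
   makes equal to [-1]. *)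
pose c := - (((w ^t* *m A *m w) 0 0 + 1) / ((w ^t* *m w) 0 0 + (w ^t* *m w) 0 0)).
have cJ : Num.conj c = c.
  rewrite /c rmorphN /= geC0_conj //.
  by rewrite divr_ge0 ?addr_ge0 ?ler01 ?pA ?adjmx_mul_ge0.
have := pA (1 *: w + c *: v); rewrite sesqui_lin_comb ?rmorph1 //.
rewrite vA -(mulmxA _ A v) -/w /c; move: N0 v0; rewrite vA.
move: (w ^t* *m A *m w) (w ^t* *m w) (w ^t* *m v) => H W V N0 V0.
rewrite !mxE V0 (_ : _ + _ = - 1); first by rewrite oppr_ge0 ler10.
by field; rewrite -mulr2n mulrn_eq0.
Qed.

Lemma singular_kernel n (A : 'M[C]_n) : A \notin unitmx ->
  exists2 v : 'cV[C]_n, v != 0 & A *m v = 0.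
Proof.
rewrite unitmxE unitfE negbK -det_tr => /det0P[v v0 vA]; exists v^T.
  by rewrite -trmx0 (inj_eq (@trmx_inj _ _ _)).
by apply: trmx_inj; rewrite trmx_mul trmxK vA trmx0.
Qed.

End HermitianForms.

(** * Closure properties of semidefinite matrices *)

Section SemidefiniteMatrices.
Variable R : realType.
Local Notation C := R[i].

Lemma psdmxD n (A B : 'M[C]_n) : psdmx A -> psdmx B -> psdmx (A + B).
Proof.
move=> [/hermsymP hA pA] [/hermsymP hB pB]; split.
  by apply/hermsymP; rewrite adjmxD hA hB.
by move=> v; rewrite mulmxDr mulmxDl mxE addr_ge0.
Qed.

Lemma psdmxZ n (a : C) (A : 'M[C]_n) : 0 <= a -> psdmx A -> psdmx (a *: A).
Proof.
move=> a0 [/hermsymP hA pA]; split.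
  by apply/hermsymP; rewrite adjmxZ hA geC0_conj.
by move=> v; rewrite -scalemxAr -scalemxAl mxE mulr_ge0.
Qed.

Lemma psdmx_congr m n (A : 'M[C]_m) (X : 'M[C]_(m, n)) :
  psdmx A -> psdmx (X ^t* *m A *m X).
Proof.
move=> [/hermsymP hA pA]; split.
  by apply/hermsymP; rewrite !adjmxM hA trmxCK mulmxA.
by move=> v; have := pA (X *m v); rewrite adjmxM !mulmxA.
Qed.

Lemma psdmx_scalar1 (c : C) : psdmx (c%:M : 'M_1) <-> 0 <= c.
Proof.
split=> [[_ /(_ 1%:M)]|c0]; first by rewrite adjmx_scalar rmorph1 mul1mx mulmx1 mxE.
split; first by apply/hermsymP; rewrite adjmx_scalar geC0_conj.
move=> v; rewrite mul_mx_scalar -scalemxAl mxE mulr_ge0 //; exact: adjmx_mul_ge0.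
Qed.

End SemidefiniteMatrices.

(** * Convex combinations and inverses of hyper-positive functions *)

Section HyperPositiveFunctions.
Variable R : realType.
Local Notation C := R[i].
Variables (m : nat) (T : 'M[C]_m).
Implicit Types (F G : ratmx R m) (s : C) (A : 'M[C]_m).

Lemma has_mxval_val F s : mxregular F s -> has_mxval F s (mxval F s).
Proof. by move=> Fs i j; rewrite mxE; exact: regular_has_val. Qed.

Lemma has_mxval_regular F s A : has_mxval F s A -> mxregular F s.
Proof. by move=> FA i j; exact: has_val_regular (FA i j). Qed.

Lemma has_mxval_mxval F s A : has_mxval F s A -> mxval F s = A.
Proof. by move=> FA; apply/matrixP => i j; rewrite mxE; exact: has_val_ratval. Qed.

Lemma HP_of_has_mxval F :
  (forall s, 0 < complex.Re s -> exists2 A, has_mxval F s A & psdmx (defect T A)) ->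
  HP T F.
Proof.
move=> hF s /hF[A FA pA]; split; first exact: has_mxval_regular FA.
by rewrite (has_mxval_mxval FA).
Qed.

(** The defect of [F] is rational on the axis wherever [F] is regular. Points where auxiliary
    functions have poles that cancel in [F] may therefore be ignored. *)
Lemma canonical_of_cofinitely F : HP T F ->
  cofinitely (fun s => complex.Re s = 0 -> exists2 A, has_mxval F s A & defect T A = 0) ->
  canonical_HP T F.
Proof.
move=> hF cF; split=> // s s0 Fs.
apply: (@axis_rationalmx_eq0 _ (mxregular F) _ _ (fun s => defect T (mxval F s))) s0 Fs.
- have AF := @axis_rationalmx_val _ (mxregular F) _ F (fun _ h => h).
  have AT := @axis_rationalmx_const _ (mxregular F) _ _ T.
  apply: axis_rationalmxD (axis_rationalmxD AF (axis_rationalmx_adjoint AF)) _.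
  apply/axis_rationalmxN/(axis_rationalmxD AT).
  exact: (axis_rationalmxM (axis_rationalmxM (axis_rationalmx_adjoint AF) AT) AF).
- exact: cofinitely_regularmx.
- by apply: cofinitely_imp cF => z hz /hz[A FA dA]; rewrite (has_mxval_mxval FA).
Qed.

Lemma has_mxval_cvx_comb F0 F1 (a : R) s A0 A1 :
  has_mxval F0 s A0 -> has_mxval F1 s A1 ->
  has_mxval (cvx_comb F0 F1 a) s (a%:C *: A1 + (1 - a)%:C *: A0).
Proof.
by move=> ? ?; apply: has_mxvalD; apply: has_mxvalZ => //; exact: has_val_const.
Qed.

Lemma defect_cvx_comb (a : R) A0 A1 :
  defect T (a%:C *: A1 + (1 - a)%:C *: A0) =
  a%:C *: defect T A1 + (1 - a)%:C *: defect T A0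
  + (a * (1 - a))%:C *: ((A0 - A1) ^t* *m T *m (A0 - A1)).
Proof.
rewrite (rmorphM _ a (1 - a)) /=; apply: defect_cvx; try exact: conjc_real.
by rewrite -rmorphD addrC subrK rmorph1.
Qed.

Lemma HP_cvx_comb F0 F1 (a : R) : psdmx T -> 0 <= a <= 1 ->
  HP T F0 -> HP T F1 -> HP T (cvx_comb F0 F1 a).
Proof.
move=> T0 /andP[a0 a1] h0 h1; apply: HP_of_has_mxval => s s0.
have [[r0 p0] [r1 p1]] := (h0 s s0, h1 s s0).
exists (a%:C *: mxval F1 s + (1 - a)%:C *: mxval F0 s).
  by apply: has_mxval_cvx_comb; exact: has_mxval_val.
have pos (c : R) : 0 <= c -> 0 <= c%:C by rewrite ler0c.
have a1' : 0 <= 1 - a by rewrite subr_ge0.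
rewrite defect_cvx_comb; apply: psdmxD; first apply: psdmxD.
- exact: psdmxZ (pos _ a0) p1.
- exact: psdmxZ (pos _ a1') p0.
- exact: psdmxZ (pos _ (mulr_ge0 a0 a1')) (psdmx_congr _ T0).
Qed.

(** Where [F0] and [F1] are both regular, all three defects vanish, leaving [a (1 - a)] times the
    isotropy term. Rationality on the axis then covers the points where common poles cancel in
    [F0 - F1]. A single interior weight suffices. *)
Lemma canonical_cvx_comb_isotropic F0 F1 (a : R) : 0 < a < 1 ->
  canonical_HP T F0 -> canonical_HP T F1 -> canonical_HP T (cvx_comb F0 F1 a) ->
  forall s, complex.Re s = 0 -> mxregular (F0 - F1) s ->
    (mxval (F0 - F1) s) ^t* *m T *m mxval (F0 - F1) s = 0.
Proof.
move=> /andP[a0 a1] [_ h0] [_ h1] [_ ha].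
have AF := @axis_rationalmx_val _ (mxregular (F0 - F1)) _ (F0 - F1) (fun _ h => h).
have AT := @axis_rationalmx_const _ (mxregular (F0 - F1)) _ _ T.
apply: axis_rationalmx_eq0; first 2 last.
- apply: cofinitely_imp (cofinitely_and (cofinitely_regularmx F0) (cofinitely_regularmx F1)).
  move=> s [r0 r1] s0; have [v0 v1] := (has_mxval_val r0, has_mxval_val r1).
  have va := has_mxval_cvx_comb a v0 v1.
  have e0 : defect T (mxval F0 s) = 0 := h0 s s0 r0.
  have e1 : defect T (mxval F1 s) = 0 := h1 s s0 r1.
  have ea : defect T (mxval (cvx_comb F0 F1 a) s) = 0 := ha s s0 (has_mxval_regular va).
  move: ea; rewrite (has_mxval_mxval va) (has_mxval_mxval (has_mxvalD v0 (has_mxvalN v1))).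
  rewrite defect_cvx_comb e0 e1 !scaler0 !add0r.
  move/eqP; rewrite scaler_eq0 => /orP[|/eqP//].
  by rewrite (inj_eq (@complexI _) _ 0) mulf_eq0 subr_eq0 gt_eqF //= gt_eqF.
- exact: (axis_rationalmxM (axis_rationalmxM (axis_rationalmx_adjoint AF) AT) AF).
- exact: cofinitely_regularmx.
Qed.

Lemma isotropic_canonical_cvx_comb F0 F1 (a : R) : psdmx T -> 0 <= a <= 1 ->
  canonical_HP T F0 -> canonical_HP T F1 ->
  (forall s, complex.Re s = 0 -> mxregular (F0 - F1) s ->
    (mxval (F0 - F1) s) ^t* *m T *m mxval (F0 - F1) s = 0) ->
  canonical_HP T (cvx_comb F0 F1 a).
Proof.
move=> T0 a01 [h0 c0] [h1 c1] iso; apply: canonical_of_cofinitely; first exact: HP_cvx_comb.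
apply: cofinitely_imp (cofinitely_and (cofinitely_regularmx F0) (cofinitely_regularmx F1)).
move=> s [r0 r1] s0; have [v0 v1] := (has_mxval_val r0, has_mxval_val r1).
exists (a%:C *: mxval F1 s + (1 - a)%:C *: mxval F0 s); first exact: has_mxval_cvx_comb.
have vB := has_mxvalD v0 (has_mxvalN v1).
have := iso s s0 (has_mxval_regular vB); rewrite (has_mxval_mxval vB) defect_cvx_comb => ->.
have e0 : defect T (mxval F0 s) = 0 := c0 s s0 r0.
have e1 : defect T (mxval F1 s) = 0 := c1 s s0 r1.
by rewrite e0 e1 !scaler0 !addr0.
Qed.

(** The value at the single point [1] is already invertible: a null vector there would make the
    defect form negative. *)
Lemma HP_unitmx F : pdmx T -> HP T F -> F \in unitmx.
Proof.
move=> [_ T0] hF; have [r [_ p]] := hF 1 ltr01.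
suff : mxval F 1 \in unitmx.
  rewrite !unitmxE !unitfE; apply: contraNneq => dF.
  have := has_val_det (has_mxval_val r); rewrite dF => /has_val_ratval <-.
  by apply/eqP; exact: has_val_ratval (has_val0 _).
apply: contraT => /singular_kernel[v v0 Fv]; have := p v.
have -> := form_defect_kernel T Fv.
by rewrite oppr_ge0 => /(lt_le_trans (T0 v v0)); rewrite ltxx.
Qed.

(* A null vector [v] of [F s0] makes [v^* F v] a positive real function with an
   interior zero, hence zero; then [F + F^*] kills [v] throughout the half-plane.
   The entries of [F v] are thus minus the conjugates of those of [v^* F], and
   apply the same principle to their sum and to [i] times their difference. *)
Lemma HP_interior_kernel F s0 (v : 'cV[C]_m) : psdmx T -> HP T F ->
  0 < complex.Re s0 -> mxval F s0 *m v = 0 -> F *m constmx v = 0.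
Proof.
move=> T0 hF s0pos Fv.
have reg s : 0 < complex.Re s -> mxregular F s by case/hF.
have pF s : 0 < complex.Re s -> psdmx (mxval F s + (mxval F s) ^t*).
  move=> /hF[_ pd]; have := psdmxD pd (psdmxD T0 (psdmx_congr (mxval F s) T0)).
  by rewrite subrK.
pose form (u w : 'cV[C]_m) := constmx (u ^t*) *m F *m constmx w.
have formE u w s : 0 < complex.Re s -> has_val (form u w 0 0) s ((u ^t* *m mxval F s *m w) 0 0).
  move=> /reg/has_mxval_val Fs.
  exact: has_mxvalM (has_mxvalM (has_mxval_const _ _) Fs) (has_mxval_const _ _) 0 0.
have formJ (u w : 'cV[C]_m) s : ((u ^t* *m (mxval F s) ^t* *m w) 0 0) = Num.conj ((w ^t* *m mxval F s *m u) 0 0).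
  have -> : u ^t* *m (mxval F s) ^t* *m w = (w ^t* *m mxval F s *m u) ^t*.
    by rewrite !adjmxM trmxCK mulmxA.
  by rewrite [LHS]mxE mxE.
have formD (u w : 'cV[C]_m) s : ((u ^t* *m (mxval F s + (mxval F s) ^t*) *m w) 0 0) =
    (u ^t* *m mxval F s *m w) 0 0 + Num.conj ((w ^t* *m mxval F s *m u) 0 0).
  by rewrite -formJ mulmxDr mulmxDl [LHS]mxE.
have vanish (g : {fraction {poly C}}) (h : C -> C) :
    (forall s, 0 < complex.Re s -> has_val g s (h s)) ->
    (forall s, 0 < complex.Re s -> 0 <= complex.Re (h s)) -> h s0 = 0 -> g = 0.
  move=> gh hpos h0; apply: (zero_of_positive_real _ s0pos).
    move=> s spos; split; first exact: has_val_regular (gh s spos).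
    by rewrite (has_val_ratval (gh s spos)) hpos.
  by rewrite (has_val_ratval (gh s0 s0pos)).
have vv s : 0 < complex.Re s -> (v ^t* *m mxval F s *m v) 0 0 = 0.
  move=> spos; suff g0 : form v v 0 0 = 0.
    by rewrite -(has_val_ratval (formE v v s spos)) g0; exact: has_val_ratval (has_val0 _).
  apply: vanish (formE v v) _ _; last by rewrite -mulmxA Fv mulmx0 mxE.
  move=> z zpos; have [_ /(_ v)] := pF z zpos; rewrite formD lecE => /andP[_].
  by case: (_ 0 0) => x y /=; rewrite -mulr2n pmulrn_lge0.
have opp (u : 'cV[C]_m) s : 0 < complex.Re s ->
    (u ^t* *m mxval F s *m v) 0 0 = - Num.conj ((v ^t* *m mxval F s *m u) 0 0).
  move=> spos; have v0 := formD v v s; rewrite vv // rmorph0 addr0 in v0.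
  apply/eqP; rewrite -addr_eq0 -formD -mulmxA.
  by rewrite (psd_form_kernel (pF s spos).1 (pF s spos).2 v0) mulmx0 mxE.
have s0u (u : 'cV[C]_m) : (u ^t* *m mxval F s0 *m v) 0 0 = 0 by rewrite -mulmxA Fv mulmx0 mxE.
have s0u' (u : 'cV[C]_m) : (v ^t* *m mxval F s0 *m u) 0 0 = 0.
  by move/eqP: (opp u s0 s0pos); rewrite s0u eq_sym oppr_eq0 conjC_eq0 => /eqP.
have form0 u : form u v 0 0 = 0.
  (* By [opp] the sum has the form [z - conj z], of real part zero, and it vanishes at [s0]. *)
  have sum0 : form u v 0 0 + form v u 0 0 = 0.
    apply: (vanish _ _ (fun s spos => has_valD (formE u v s spos) (formE v u s spos))).
      by move=> s spos /=; rewrite opp //; case: (_ 0 0) => x y /=; rewrite addNr.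
    by rewrite /= s0u s0u' addr0.
  (* The difference is real-valued on the half-plane, so multiplying by [i] again gives real part
     zero. *)
  have dif0 : ('i%C%:P)%:F * (form u v 0 0 - form v u 0 0) = 0.
    apply: (vanish _ _ (fun s spos => has_valM (has_val_const 'i%C s)
      (has_valD (formE u v s spos) (has_valN (formE v u s spos))))).
      move=> s spos /=; rewrite opp //; case: (_ 0 0) => x y /=.
      by rewrite opprK subrr mulr0 mul0r subr0.
    by rewrite /= s0u s0u' subrr mulr0.
  have const_neq0 (c : C) : c != 0 -> (c%:P)%:F != 0 by rewrite tofrac_eq0 polyC_eq0.
  move/eqP: dif0; rewrite mulf_eq0 subr_eq0 (negPf (const_neq0 _ (neq0Ci _))) /=.
  move/eqP => eq_form; move/eqP: sum0; rewrite -eq_form -mulr2n -mulr_natl mulf_eq0.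
  have -> : 2%:R = ((2%:R : C)%:P)%:F by rewrite !rmorph_nat.
  by rewrite (negPf (const_neq0 _ _)) ?pnatr_eq0 //= => /eqP.
apply/matrixP => i j; rewrite [RHS]mxE ord1.
(* Taking a basis vector for [u] reads off the [i]-th entry of [F v]. *)
have := form0 (delta_mx i 0); rewrite /form -mulmxA.
have -> : constmx ((delta_mx i 0 : 'cV[C]_m) ^t*) = delta_mx 0 i.
  by apply/matrixP => k l; rewrite !mxE andbC; case: (_ && _); rewrite ?rmorph1 ?rmorph0.
by rewrite -rowE [LHS]mxE.
Qed.

(** A null vector of one interior value would be a constant null vector of the invertible [F]. *)
Lemma HP_mxval_unitmx F s : psdmx T -> HP T F -> F \in unitmx ->
  0 < complex.Re s -> mxval F s \in unitmx.
Proof.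
move=> T0 hF Fu spos; apply: contraT => /singular_kernel[v v0 /(HP_interior_kernel T0 hF spos) Fv].
have : constmx v = 0 by rewrite -[constmx v](mulKmx Fu) Fv mulmx0.
move/matrixP => cv; case/eqP: v0; apply/matrixP => i j; have := cv i j; rewrite !mxE.
by move/eqP; rewrite tofrac_eq0 polyC_eq0 => /eqP.
Qed.

Lemma canonical_invmx F : psdmx T -> canonical_HP T F -> F \in unitmx ->
  canonical_HP T (invmx F).
Proof.
move=> T0 [hF cF] Fu; apply: canonical_of_cofinitely.
  apply: HP_of_has_mxval => s spos; have Au := HP_mxval_unitmx T0 hF Fu spos.
  have [r p] := hF s spos.
  exists (invmx (mxval F s)); first exact: has_mxvalV (has_mxval_val r).
  have p0 : psdmx (defect T (mxval F s)) := p.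
  by rewrite (defect_inv T Au); exact: psdmx_congr (invmx (mxval F s)) p0.
apply: cofinitely_imp (cofinitely_and (cofinitely_regularmx F) (cofinitely_regularmx (invmx F))).
move=> s [rF rV] s0; have [vF vV] := (has_mxval_val rF, has_mxval_val rV).
(* On the axis invertibility of the value comes from regularity of both [F] and its inverse, not
   from the kernel argument. *)
have VF : mxval (invmx F) s *m mxval F s = 1%:M.
  have := has_mxvalM vV vF; rewrite mulVmx // => /has_mxval_mxval <-.
  apply: has_mxval_mxval => i j; rewrite !mxE.
  by case: eqP => _; [exact: has_val1|exact: has_val0].
have [_ Au] := mulmx1_unit VF.
have eV : mxval (invmx F) s = invmx (mxval F s) by rewrite -[LHS](mulmxK Au) VF mul1mx.
exists (invmx (mxval F s)); first by rewrite -eV.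
have e0 : defect T (mxval F s) = 0 := cF s s0 rF.
by rewrite (defect_inv T Au) e0 mulmx0 mul0mx.
Qed.

End HyperPositiveFunctions.

(** * The scalar transform [(f + 1/f) / 2] *)

Section ScalarFunctions.

Lemma defect_scalar1 (C : numClosedFieldType) (b z : C) :
  defect b%:M (z%:M : 'M_1) = (z + Num.conj z - (b + Num.conj z * b * z))%:M.
Proof. by rewrite /defect adjmx_scalar -!scalar_mxM -!raddfD -raddfB. Qed.

(** For [0 < b < 1] the second factor and the denominator are nonnegative, so the sign and the
    vanishing of the defect pass from [z] to [w]. *)
Lemma joukowski_defect (C : numClosedFieldType) (b z : C) :
  Num.conj b = b -> b != 0 -> z != 0 -> 1 + b ^+ 2 != 0 ->
  let w := 2^-1 * (z + z^-1) in
  let b1 := (2^-1 * (b + b^-1))^-1 in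
  w + Num.conj w - (b1 + Num.conj w * b1 * w) =
  (z + Num.conj z - (b + Num.conj z * b * z))
  * ((1 - b) * (1 + z * Num.conj z) + b * ((1 - z) * Num.conj (1 - z)))
  / (2 * (z * Num.conj z) * (1 + b ^+ 2)).
Proof.
move=> bJ b0 z0 b2 w b1.
have -> : Num.conj w = 2^-1 * (Num.conj z + (Num.conj z)^-1).
  by rewrite rmorphM rmorphD /= !fmorphV rmorph_nat.
have -> : Num.conj (1 - z) = 1 - Num.conj z by rewrite rmorphB rmorph1.
have : Num.conj z != 0 by rewrite conjC_eq0.
(* The identity remains true with [conj z] as an independent variable [y]. *)
rewrite {}/w {}/b1; move: (Num.conj z) => y y0.
by field; rewrite b0 z0 y0 b2.
Qed.

Variable R : realType.
Local Notation C := R[i].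
Implicit Types (f : {fraction {poly C}}) (b : R) (s z : C).

Lemma has_mxval_scalar1 f s z : has_val f s z -> has_mxval (f%:M : ratmx R 1) s z%:M.
Proof. by move=> fz i j; rewrite !ord1 !mxE !mulr1n. Qed.

Lemma has_val_joukowski f s z : z != 0 -> has_val f s z ->
  has_val (2^-1 * (f + f^-1)) s (2^-1 * (z + z^-1)).
Proof.
move=> z0 fz; apply: has_valM; last by apply: has_valD => //; exact: has_valV.
apply: has_valV; first by rewrite pnatr_eq0.
have := has_val_const (2%:R : C) s; rewrite !rmorph_nat; exact.
Qed.

(** At [z = 0] the defect would be [- b]. *)
Lemma defect_scalar_neq0 b z : 0 < b ->
  0 <= z + Num.conj z - (b%:C + Num.conj z * b%:C * z) -> z != 0.
Proof.
move=> b0; apply: contraTneq => ->.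
rewrite rmorph0 !(mul0r, mulr0, addr0) sub0r oppr_ge0.
by apply/negP => /(lt_le_trans (_ : 0 < b%:C)); rewrite ltxx (ltcR 0) b0 => /(_ isT).
Qed.

Lemma joukowski_scalar_canonical b f : 0 < b < 1 -> scalar_canonical_HP b f ->
  scalar_canonical_HP (2^-1 * (b + b^-1))^-1 (2^-1 * (f + f^-1)).
Proof.
move=> /andP[b0 b1] [hf cf].
have val s : mxregular (f%:M : ratmx R 1) s ->
    has_val f s (ratval f s) /\ mxval (f%:M : ratmx R 1) s = (ratval f s)%:M.
  move=> /(_ 0 0); rewrite mxE mulr1n => /regular_has_val fs; split=> //.
  exact/has_mxval_mxval/has_mxval_scalar1.
have b0C : 0 < b%:C by rewrite (ltcR 0).
have b1C : 0 < 1 - b%:C by rewrite subr_gt0 (ltcR _ 1).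
have bJ : Num.conj b%:C = b%:C by exact: conjc_real.
have b2C : 0 < 1 + b%:C ^+ 2 by rewrite addr_gt0 ?ltr01 ?exprn_gt0.
have eb1 : ((2^-1 * (b + b^-1))^-1)%:C = (2^-1 * (b%:C + b%:C^-1))^-1.
  by rewrite fmorphV rmorphM rmorphD /= !fmorphV rmorph_nat.
apply: canonical_of_cofinitely.
  apply: HP_of_has_mxval => s spos; have [reg p] := hf s spos.
  have [fs Fs] := val s reg; set z := ratval f s in fs Fs.
  have {p} : psdmx (defect (b%:C%:M) (mxval (f%:M : ratmx R 1) s)) := p.
  rewrite Fs defect_scalar1 => /psdmx_scalar1 d0.
  have z0 := defect_scalar_neq0 b0 d0.
  exists (2^-1 * (z + z^-1))%:M; first exact/has_mxval_scalar1/has_val_joukowski.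
  rewrite defect_scalar1; apply/psdmx_scalar1; rewrite eb1.
  rewrite (joukowski_defect bJ (lt0r_neq0 b0C) z0 (lt0r_neq0 b2C)).
  have E0 : 0 <= (1 - b%:C) * (1 + z * Num.conj z) + b%:C * ((1 - z) * Num.conj (1 - z)).
    apply: addr_ge0; apply: mulr_ge0; rewrite ?mul_conjC_ge0 ?(ltW b0C) ?(ltW b1C) //.
    by apply: addr_ge0; rewrite ?ler01 ?mul_conjC_ge0.
  apply: divr_ge0; first exact: mulr_ge0.
  by apply: mulr_ge0 (ltW b2C); apply: mulr_ge0; rewrite ?ler0n ?mul_conjC_ge0.
apply: cofinitely_imp (cofinitely_regularmx (f%:M : ratmx R 1)) => s reg s0.
have [fs Fs] := val s reg; set z := ratval f s in fs Fs.
have : defect (b%:C%:M) (mxval (f%:M : ratmx R 1) s) = 0 := cf s s0 reg.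
rewrite Fs defect_scalar1 => /matrixP/(_ 0 0); rewrite !mxE mulr1n => d0.
have z0 : z != 0 by apply: defect_scalar_neq0 b0 _; rewrite d0.
exists (2^-1 * (z + z^-1))%:M; first exact/has_mxval_scalar1/has_val_joukowski.
rewrite defect_scalar1 eb1 (joukowski_defect bJ (lt0r_neq0 b0C) z0 (lt0r_neq0 b2C)) d0 !mul0r.
by rewrite raddf0.
Qed.

End ScalarFunctions.

(** * Assembly of the statements on convex hulls, inverses and the scalar transform *)

Theorem theorem1p7 (R : realType) (m : nat) (T : 'M[R[i]]_m)
    (hT0 : loewner_le 0 T) (hT1 : loewner_lt T 1%:M) :
  (* (i) *)
  (forall F0 F1 : ratmx R m, canonical_HP T F0 -> canonical_HP T F1 ->
     let isotropic := forall s : R[i], complex.Re s = 0 ->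
       mxregular (F0 - F1) s ->
       (mxval (F0 - F1) s) ^t* *m T *m mxval (F0 - F1) s = 0 in
     ((forall a : R, 0 <= a <= 1 -> canonical_HP T (cvx_comb F0 F1 a))
        <-> isotropic)
     /\
     (~ isotropic ->
        (forall a : R, 0 < a < 1 -> ~ canonical_HP T (cvx_comb F0 F1 a))
        /\
        exists That : 'M[R[i]]_m,
          loewner_lt That 1%:M /\ loewner_le T That /\
          forall a : R, 0 < a < 1 -> HP That (cvx_comb F0 F1 a)))
  /\
  (* (ii) *)
  (forall F : ratmx R m, canonical_HP T F ->
     (pdmx T -> F \in unitmx) /\
     (F \in unitmx -> canonical_HP T (invmx F)))
  /\
  (* (iii) *)
  (forall (b : R) (f : {fraction {poly R[i]}}), 0 < b < 1 ->
     scalar_canonical_HP b f ->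
     let b1 : R := (2^-1 * (b + b^-1))^-1 in
     0 <= b1 < 1 /\
     scalar_canonical_HP b1 (2^-1 * (f + f^-1))).
Proof.
have T0 : psdmx T by move: hT0; rewrite /loewner_le subr0.
split; last split.
- move=> F0 F1 h0 h1 iso; split; first split=> [hcvx|hiso a a01].
  (* The midpoint serves as the interior weight. *)
  + have half : 0 < (2^-1 : R) < 1 by rewrite invr_gt0 ltr0n invf_lt1 ?ltr0n // ltr1n.
    apply: (canonical_cvx_comb_isotropic half h0 h1 (hcvx _ _)).
    by case/andP: half => /ltW-> /ltW->.
  + exact: isotropic_canonical_cvx_comb.
  + move=> niso; split=> [a a01 ha|].
      by apply: niso; exact: canonical_cvx_comb_isotropic a01 h0 h1 ha.
    (* [T] itself is a witness, since [HP T] is convex. *)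
    exists T; split; [exact: hT1|split].
      by rewrite /loewner_le subrr -(scale0r T); exact: psdmxZ.
    move=> a /andP[a0 a1]; apply: HP_cvx_comb h0.1 h1.1 => //.
    by rewrite !ltW.
(* Singular [T] admits singular canonical functions, such as [F = 0] for [T = 0]; invertibility is
   derived for positive definite [T]. *)
- move=> F hF; split=> [T0' | Fu]; first exact: HP_unitmx T0' hF.1.
  exact: canonical_invmx.
- move=> b f /andP[b0 b1] hf; split; last by apply: joukowski_scalar_canonical hf; rewrite b0.
  (* This quantity is [b + 1/b - 2]; its positivity is strict AM-GM and yields [b1 < 1]. *)
  have bV : 0 < b^-1 * (1 - b) ^+ 2 by rewrite mulr_gt0 ?invr_gt0 // exprn_gt0 // subr_gt0.
  have eV : b^-1 * (1 - b) ^+ 2 = b + b^-1 - 2 by field; rewrite gt_eqF.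
  rewrite eV in bV; have gt1 : 1 < 2^-1 * (b + b^-1) by lra.
  by rewrite invr_ge0 invf_lt1 ?ltW //; apply: lt_trans gt1.
Qed.
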